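(* Let $A$ be a $C^*$-algebra such that $QM(A)\ne LM(A)+RM(A)$. Then there exists $\epsilon>0$ such that for every $\delta>0$ there exists $h\in QM(A)$ such that $1-\delta\le h\le 1+\delta$ and there does not exist $T\in LM(A)$ with $\|T-1\|<\epsilon$ and $T^*T=h$.
   Context: For a $C^*$-algebra $A$ with enveloping von Neumann algebra $A^{**}$ (with unit $1$): $LM(A)=\{T\in A^{**}: TA\subset A\}$, $RM(A)=\{T\in A^{**}: AT\subset A\}$, $QM(A)=\{T\in A^{**}: ATA\subset A\}$. *)

(* Defs.v *)
From HB Require Import structures.
From mathcomp Require Import all_boot all_order all_algebra.
From mathcomp Require Import complex.
From mathcomp Require Import boolp classical_sets reals topology normedtype.

Set Implicit Arguments.
Unset Strict Implicit.
Unset Printing Implicit Defensive.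

Import Order.TTheory GRing.Theory Num.Theory.
Import numFieldNormedType.Exports.

Local Open Scope classical_set_scope.
Local Open Scope complex_scope.
Local Open Scope ring_scope.

(* Norms of complex normed spaces take their values in the nonnegative reals  *)
(* of R[i]; [0 <= z] in R[i] means that z is real and nonnegative.            *)

(* C*-algebras need not be unital, hence cannot be built on pzRingType. *)
HB.mixin Record isCStarAlgebra (R : realType) A
    of CompleteNormedModule R[i] A := {
  amul : {bilinear A -> A -> A} ;
  star : A -> A ;
  amulA : associative amul ;
  amul_norm : forall a b, `|amul a b| <= `|a| * `|b| ;
  starK : involutive star ;
  starD : {morph star : a b / a + b} ;
  starZ : forall (c : R[i]) a, star (c *: a) = Num.conj c *: star a ;
  starM : forall a b, star (amul a b) = amul (star b) (star a) ;
  cstar_identity : forall a, `|amul (star a) a| = `|a| ^+ 2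
}.

#[short(type="cstarAlgType")]
HB.structure Definition CStarAlgebra (R : realType) :=
  {A of CompleteNormedModule R[i] A & isCStarAlgebra R A}.

(* The inner product is linear in its first variable. *)
HB.mixin Record isHilbert (R : realType) H
    of CompleteNormedModule R[i] H := {
  hdot : {dot H for Num.conj} ;
  hdot_normE : forall x, hdot x x = `|x| ^+ 2
}.

#[short(type="hilbertType")]
HB.structure Definition Hilbert (R : realType) :=
  {H of CompleteNormedModule R[i] H & isHilbert R H}.

(* [sup] is 0 on unbounded sets, so this is the usual operator norm only for  *)
(* bounded f.                                                                 *)
Definition opnorm (R : realType) (V W : normedZmodType R[i]) (f : V -> W) : R :=
  sup [set complex.Re `|f x| | x in [set x | `|x| <= 1]].

Section Operators.
Context {R : realType} {H : hilbertType R}.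
Implicit Types (S T : H -> H) (X : set (H -> H)).

(* B(H) *)
Definition bounded_op : set (H -> H) := [set T | linear T /\ continuous T].

(* For T in B(H), the vector z below exists (Riesz) and is unique. *)
Definition adjoint T : H -> H :=
  fun y => xget 0 [set z | forall x, hdot (T x) y = hdot x z].

Definition scalar_op (c : R) : H -> H := fun x => c%:C *: x.

(* H being complex, nonnegativity of the quadratic form of T - S forces T - S *)
(* to be selfadjoint.                                                         *)
Definition op_le S T := forall x, 0 <= hdot (T x - S x) x.

Definition commutant X : set (H -> H) :=
  [set T | bounded_op T /\ forall S, X S -> T \o S = S \o T].

End Operators.

Record state (R : realType) (A : cstarAlgType R) := State {
  state_fun :> A -> R[i] ;
  state_linear : scalar state_fun ;
  state_ge0 : forall a, 0 <= state_fun (amul (star a) a) ;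
  state_norm : opnorm state_fun = 1
}.

Section EnvelopingVonNeumannAlgebra.
Context {R : realType} {A : cstarAlgType R} {H : hilbertType R}.
Implicit Types (pi : A -> H -> H).

Definition star_representation pi :=
  [/\ forall a, bounded_op (pi a),
      forall x, linear (pi^~ x),
      forall a b, pi (amul a b) = pi a \o pi b &
      forall a x y, hdot (pi a x) y = hdot x (pi (star a) y)].

(* pi is (unitarily equivalent to) the direct sum, over all states phi of A,  *)
(* of the GNS representations (H_phi, pi_phi, xi phi): H_phi is the closure   *)
(* of pi(A)(xi phi), these spaces are pairwise orthogonal, and together they  *)
(* span a dense subspace of H.                                                *)
Definition universal_representation pi :=
  star_representation pi /\
  exists xi : state A -> H,
    [/\ forall phi a, hdot (pi a (xi phi)) (xi phi) = phi a,
        forall phi, closure (range (fun a => pi a (xi phi))) (xi phi),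
        forall phi psi, phi <> psi ->
          forall a b, hdot (pi a (xi phi)) (pi b (xi psi)) = 0 &
        dense (range (fun s : seq (state A * A) =>
                        \sum_(p <- s) pi p.2 (xi p.1)))].

(* When pi is universal, the bicommutant of pi(A) is A**, in which A is       *)
(* identified with pi(A).                                                     *)
Definition enveloping pi : set (H -> H) := commutant (commutant (range pi)).

Definition LM pi : set (H -> H) :=
  [set T | enveloping pi T /\ forall a, range pi (T \o pi a)].

Definition RM pi : set (H -> H) :=
  [set T | enveloping pi T /\ forall a, range pi (pi a \o T)].

Definition QM pi : set (H -> H) :=
  [set T | enveloping pi T /\ forall a b, range pi (pi a \o T \o pi b)].

End EnvelopingVonNeumannAlgebra.

(* Main.v *)
Require Import Defs.
From HB Require Import structures.
From mathcomp Require Import all_boot all_order all_algebra.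
From mathcomp Require Import complex.
From mathcomp Require Import boolp classical_sets reals topology normedtype.
From mathcomp Require Import ring lra.

Set Implicit Arguments.
Unset Strict Implicit.
Unset Printing Implicit Defensive.

Import Order.TTheory GRing.Theory Num.Theory.
Import numFieldNormedType.Exports.

Local Open Scope classical_set_scope.
Local Open Scope ring_scope.


(** Suppose that the conclusion fails, for the bound [1 / 8] on [|T - 1|]: then
    some [delta > 0] is such that every quasi-multiplier [h] with
    [1 - delta <= h <= 1 + delta] factors as [T^* T], where [T] is a left
    multiplier and [|T - 1| < 1 / 8]. The claim is that every quasi-multiplier is
    then the sum of a left and a right multiplier.

    Take a selfadjoint quasi-multiplier [X] with [|X| <= delta] and write
    [1 + X = T^* T]. With [T^-1 = 1 + Z] this reads [T^* = (1 + X) (1 + Z)], that is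
    [X = - Z + (T^* - 1) - X Z]. Here [Z] is a left multiplier, [T^* - 1] is a right
    multiplier, both of norm at most [1], and [X Z] is a quasi-multiplier of norm
    at most [delta / 4] (splits_unit). By scaling, any selfadjoint quasi-multiplier
    [X] is a sum of multipliers of norm at most [|X| / delta], up to a
    quasi-multiplier of norm at most [|X| / 4]; passing to real and imaginary
    parts, any quasi-multiplier is a sum of multipliers of norm at most
    [2 |X| / delta], up to half of its norm (splits_general). Repeating this on the
    remainders yields geometric series of left and of right multipliers with total
    sum [X] (QM_sum).

    Two facts of operator theory make this work. Adjoints exist, by the Riesz
    representation theorem. And norm limits of left (right) multipliers are left
    (right) multipliers, which is also what makes [T^-1] a left multiplier; this
    comes from the norm closedness of the range of the representation [pi]
    (rep_range_closed). For the latter, an element [a] with [|pi a| <= s] is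
    replaced by [b = ir a (a^* a + ir)^-1] with [r = 4 s^2], which has norm at most
    [3 s] in the algebra while [pi b] still approximates [pi a] up to [s / 3]
    (rep_truncate); these approximations sum up in the complete algebra. *)

(** * Real-valued norms and geometric convergence *)

Definition nrm (R : realType) (V : normedZmodType R[i]) (x : V) : R :=
  complex.Re `|x|.

Section RealNorm.
Local Open Scope complex_scope.
Context {R : realType}.

Lemma nrmE (V : normedZmodType R[i]) (x : V) : `|x| = (nrm x)%:C.
Proof. by rewrite /nrm RRe_real // normr_real. Qed.

Lemma nrm_ge0 (V : normedZmodType R[i]) (x : V) : 0 <= nrm x.
Proof. by rewrite -ler0c -nrmE normr_ge0. Qed.

Lemma nrmD (V : normedZmodType R[i]) (x y : V) : nrm (x + y) <= nrm x + nrm y.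
Proof. by rewrite -lecR rmorphD /= -!nrmE ler_normD. Qed.

Lemma nrmN (V : normedZmodType R[i]) (x : V) : nrm (- x) = nrm x.
Proof. by rewrite /nrm normrN. Qed.

Lemma nrmB (V : normedZmodType R[i]) (x y : V) : nrm (x - y) <= nrm x + nrm y.
Proof. by rewrite -(nrmN y) nrmD. Qed.

Lemma nrm0 (V : normedZmodType R[i]) : nrm (0 : V) = 0.
Proof. by rewrite /nrm normr0. Qed.

Lemma nrm_le0 (V : normedZmodType R[i]) (x : V) : nrm x <= 0 -> x = 0.
Proof.
move=> x0; apply/eqP; rewrite -normr_eq0 nrmE.
by have /eqP -> : nrm x == 0 by rewrite eq_le x0 nrm_ge0.
Qed.

Lemma nrm_gt0 (V : normedZmodType R[i]) (x : V) : x != 0 -> 0 < nrm x.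
Proof. by move=> x0; rewrite -ltcR -nrmE normr_gt0. Qed.

Lemma nrmZ (V : normedModType R[i]) (c : R[i]) (x : V) :
  nrm (c *: x) = nrm c * nrm x.
Proof. by apply: complexI; rewrite rmorphM /= -!nrmE normrZ. Qed.

Lemma nrm_real (c : R) : nrm c%:C = `|c|.
Proof. by rewrite /nrm normc_def /= expr0n /= addr0 sqrtr_sqr. Qed.

Lemma nrm_im (r : R) : nrm (0 +i* r) = `|r|.
Proof. by rewrite /nrm normc_def /= expr0n /= add0r sqrtr_sqr. Qed.

Lemma mul_im (s t : R) : (0 +i* s) * (0 +i* t) = (- (s * t))%:C :> R[i].
Proof. by apply/eqP; rewrite eq_complex /= !(mul0r, mulr0) sub0r addr0 !eqxx. Qed.

Lemma nrmZr (V : normedModType R[i]) (c : R) (x : V) :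
  nrm (c%:C *: x) = `|c| * nrm x.
Proof. by rewrite nrmZ nrm_real. Qed.

Lemma Re_le_nrm (c : R[i]) : `|complex.Re c| <= nrm c.
Proof. by rewrite -lecR -nrmE normc_ge_Re. Qed.

Lemma geometric_lt (C e : R) : 0 < e -> exists N, C / 2 ^+ N < e.
Proof.
move=> e0; exists (Num.bound `|C / e|).
rewrite ltr_pdivrMr ?exprn_gt0 // mulrC -ltr_pdivrMr //.
apply: le_lt_trans (ler_norm _) _.
apply: lt_le_trans (archi_boundP (normr_ge0 _)) _.
rewrite -natrX ler_nat.
by apply: ltnW; rewrite ltn_expl.
Qed.

Lemma geometric_le0 (C x : R) : (forall n, x <= C / 2 ^+ n) -> x <= 0.
Proof.
move=> h; rewrite leNgt; apply/negP => /(geometric_lt C) [n].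
by rewrite ltNge h.
Qed.

(** All limits below are sums of series dominated by a geometric one; this lemma
    is the only use of completeness of normed spaces. *)
Lemma geometric_series (V : completeNormedModType R[i]) (u : nat -> V) (C : R) :
  (forall n, nrm (u n) <= C / 2 ^+ n) ->
  exists l, forall n, nrm (l - \sum_(k < n) u k) <= C * 2 / 2 ^+ n.
Proof.
move=> uC; pose s n := \sum_(k < n) u k.
have tail n m : nrm (s (m + n)%N - s n) <= C * 2 / 2 ^+ n - C * 2 / 2 ^+ (m + n).
  elim: m => [|m IH]; first by rewrite !subrr nrm0.
  rewrite addSn {1}/s big_ord_recr /= -/(s _) addrAC.
  apply: le_trans (nrmD _ _) _.
  apply: le_trans (lerD IH (uC _)) _.
  rewrite exprS invfM; have := uC (m + n)%N; lra.
have C0 : 0 <= C by have := uC 0%N; rewrite expr0 divr1; apply: le_trans (nrm_ge0 _).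
have tail' n m : nrm (s (m + n)%N - s n) <= C * 2 / 2 ^+ n.
  apply: le_trans (tail n m) _; rewrite gerBl.
  by rewrite !mulr_ge0 ?invr_ge0 ?exprn_ge0.
have /cauchy_cvgP cs : cauchy (s @ \oo).
  apply: cauchy_exP => e e0.
  have [N HN] : exists N, C * 2 / 2 ^+ N < complex.Re e.
    by apply: geometric_lt; move: e0; rewrite ltcE /= => /andP[].
  exists (s N); exists N => // n /= Nn.
  rewrite -ball_normE /ball_ /= distrC nrmE ltcE /=.
  move: (e0); rewrite ltcE /= => /andP[/eqP -> _]; rewrite eqxx /=.
  by rewrite -(subnK Nn); apply: le_lt_trans (tail' _ _) HN.
exists (lim (s @ \oo)) => n; apply/ler_addgt0Pr => e e0.
have e0' : 0 < e%:C by rewrite ltcR.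
have [N _ HN] := (@cvgrPdist_lt _ _ _ _ _ _ _).1 cs _ e0'.
have := HN (n + N)%N (leq_addl _ _); rewrite /= nrmE ltcR => h.
rewrite -(subrKA (s (n + N)%N)); apply: le_trans (nrmD _ _) _.
rewrite addrC lerD //; last exact: ltW.
by rewrite addnC.
Qed.

End RealNorm.
(** * Bounded operators and their adjoints *)

Section LinearMaps.
Context {R : realType} {V W : normedModType R[i]} {T : V -> W}.
Hypothesis linT : linear T.

Let f : {linear V -> W} := HB.pack T (GRing.isLinear.Build _ _ _ _ T linT).

Lemma linD x y : T (x + y) = T x + T y. Proof. exact: (linearD f). Qed.
Lemma linB x y : T (x - y) = T x - T y. Proof. exact: (linearB f). Qed.
Lemma lin0 : T 0 = 0. Proof. exact: (linear0 f). Qed.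
Lemma linZ c x : T (c *: x) = c *: T x. Proof. exact: (@linearZ_LR _ _ _ _ f). Qed.
Lemma lin_sum n (u : 'I_n -> V) : T (\sum_k u k) = \sum_k T (u k).
Proof. exact: (linear_sum f). Qed.

End LinearMaps.

Definition bnd (R : realType) (V W : normedZmodType R[i]) (f : V -> W) (M : R) :=
  forall x, nrm (f x) <= M * nrm x.

Section Bounds.
Local Open Scope complex_scope.
Context {R : realType}.

Lemma bnd_le {V W : normedZmodType R[i]} (f : V -> W) M N :
  M <= N -> bnd f M -> bnd f N.
Proof.
by move=> MN fM x; apply: le_trans (fM x) _; rewrite ler_wpM2r // nrm_ge0.
Qed.

Lemma bndD {V W : normedZmodType R[i]} (f g : V -> W) M N :
  bnd f M -> bnd g N -> bnd (f \+ g) (M + N).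
Proof.
by move=> fM gN x /=; rewrite mulrDl; apply: le_trans (nrmD _ _) (lerD _ _).
Qed.

Lemma bndB {V W : normedZmodType R[i]} (f g : V -> W) M N :
  bnd f M -> bnd g N -> bnd (f \- g) (M + N).
Proof.
by move=> fM gN x /=; rewrite mulrDl; apply: le_trans (nrmB _ _) (lerD _ _).
Qed.

Lemma bndZ {V : normedZmodType R[i]} {W : normedModType R[i]} (k : R[i])
    (f : V -> W) M : bnd f M -> bnd (k \*: f) (nrm k * M).
Proof. by move=> fM x; rewrite /= nrmZ -mulrA ler_wpM2l ?nrm_ge0. Qed.

Lemma bnd_comp {V W U : normedZmodType R[i]} (f : W -> U) (g : V -> W) M N :
  0 <= M -> bnd f M -> bnd g N -> bnd (f \o g) (M * N).
Proof.
move=> M0 fM gN x /=; apply: le_trans (fM _) _.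
by rewrite -mulrA ler_wpM2l.
Qed.

Lemma bnd_ge0 {V W : normedZmodType R[i]} (f : V -> W) M (x : V) :
  bnd f M -> x != 0 -> 0 <= M.
Proof.
move=> fM x0; rewrite -(pmulr_lge0 M (nrm_gt0 x0)).
exact: le_trans (nrm_ge0 _) (fM x).
Qed.

Lemma bounded_opP {H : hilbertType R} (T : H -> H) :
  bounded_op T <-> linear T /\ exists2 M, 0 <= M & bnd T M.
Proof.
split=> -[linT]; pose f : {linear H -> H} :=
  HB.pack T (GRing.isLinear.Build _ _ _ _ T linT).
- move=> /(linear_bounded_continuous f)/linear_boundedP fb; split=> //.
  have /pinfty_ex_gt0 [r r0 rT] := fb.
  exists (complex.Re r); first by move: r0; rewrite ltcE /= => /andP[_ /ltW].
  move=> x; have := rT x.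
  by rewrite !nrmE -[r]RRe_real ?gtr0_real // -rmorphM /= lecR.
- move=> [M M0 TM]; split=> //.
  apply/(linear_bounded_continuous f)/linear_boundedP.
  exists (M%:C); split=> [|r Mr x]; first by rewrite ger0_real // ler0c.
  apply: (@le_trans _ _ (M%:C * `|x|)); last by rewrite ler_wpM2r // ltW.
  by rewrite !nrmE -rmorphM /= lecR; exact: TM.
Qed.

End Bounds.

Section HilbertSpace.
Local Open Scope complex_scope.
Context {R : realType} {H : hilbertType R}.
Implicit Types (x y z : H) (c : R[i]) (S T : H -> H).

Lemma hdotC x y : hdot x y = (hdot y x)^*.
Proof. by rewrite hermC expr0 mul1r. Qed.
Lemma hdotDl x y z : hdot (x + y) z = hdot x z + hdot y z.
Proof. exact: linearDl. Qed.
Lemma hdotDr x y z : hdot z (x + y) = hdot z x + hdot z y.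
Proof. exact: linearDr. Qed.
Lemma hdotBl x y z : hdot (x - y) z = hdot x z - hdot y z.
Proof. exact: linearBl. Qed.
Lemma hdotBr x y z : hdot z (x - y) = hdot z x - hdot z y.
Proof. exact: linearBr. Qed.
Lemma hdotZl c x y : hdot (c *: x) y = c * hdot x y.
Proof. exact: linearZl_LR. Qed.
Lemma hdotZr c x y : hdot x (c *: y) = c^* * hdot x y.
Proof. exact: linearZr_LR. Qed.

Lemma nrm_hdot x : hdot x x = (nrm x ^+ 2)%:C.
Proof. by rewrite hdot_normE nrmE rmorphXn. Qed.

Lemma ReC c : complex.Re (c^*) = complex.Re c. Proof. by case: c. Qed.

Lemma sqr_nrmD x y :
  nrm (x + y) ^+ 2 = nrm x ^+ 2 + nrm y ^+ 2 + 2 * complex.Re (hdot x y).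
Proof.
have := congr1 (@complex.Re R) (nrm_hdot (x + y)).
rewrite hdotDl !hdotDr !nrm_hdot (hdotC y x) /= => <-.
by case: (hdot x y) => a b /=; ring.
Qed.

Lemma Re_hdotC x y : complex.Re (hdot x y) = complex.Re (hdot y x).
Proof. by rewrite hdotC ReC. Qed.

Lemma ReZ (t : R) c : complex.Re (t%:C * c) = t * complex.Re c.
Proof. by case: c => a b /=; rewrite mul0r subr0. Qed.

Lemma Re_hdotZr (t : R) x y :
  complex.Re (hdot x (t%:C *: y)) = t * complex.Re (hdot x y).
Proof. by rewrite Re_hdotC hdotZl ReZ Re_hdotC. Qed.

Lemma Re_hdot_le x y : complex.Re (hdot x y) <= nrm x * nrm y.
Proof.
have [->|x0] := eqVneq x 0; first by rewrite /hdot linear0l nrm0 mul0r.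
have [->|y0] := eqVneq y 0; first by rewrite /hdot linear0r nrm0 mulr0.
have a0 := nrm_gt0 x0; have b0 := nrm_gt0 y0.
have := sqr_ge0 (nrm ((nrm y)%:C *: x + (- nrm x)%:C *: y)).
rewrite sqr_nrmD !nrmZr Re_hdotZr hdotZl ReZ normrN !ger0_norm ?nrm_ge0 //.
set r := complex.Re _; move: (nrm x) (nrm y) a0 b0 => a b a0 b0 h.
rewrite -(ler_pM2l (mulr_gt0 a0 b0)); nra.
Qed.

Lemma cauchy_schwarz x y : nrm (hdot x y) <= nrm x * nrm y.
Proof.
have [->|c0] := eqVneq (hdot x y) 0; first by rewrite nrm0 mulr_ge0 // nrm_ge0.
rewrite -(ler_pM2l (nrm_gt0 c0)).
have := Re_hdot_le ((hdot x y)^* *: x) y.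
rewrite hdotZl mulrC -sqr_normc nrmE -rmorphXn /= expr2 => /le_trans; apply.
by rewrite nrmZ /nrm normcJ mulrA.
Qed.

(** The minimiser of [|x|^2 - 2 Re f(x)] represents [f]. The parallelogram law
    makes every minimising sequence Cauchy. *)
Lemma riesz (f : H -> R[i]) (M : R) :
  scalar f -> (forall x, nrm (f x) <= M * nrm x) ->
  exists z, forall x, f x = hdot x z.
Proof.
move=> linf fM.
have fD x y : f (x + y) = f x + f y by have := linf 1 x y; rewrite scale1r mul1r.
have f0 : f 0 = 0.
  by have := fD 0 0; rewrite addr0 => /eqP; rewrite addrC -subr_eq subrr => /eqP.
have fZ c x : f (c *: x) = c * f x by have := linf c x 0; rewrite f0 !addr0.
pose J x := nrm x ^+ 2 - 2 * complex.Re (f x).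
have Jlb x : - M ^+ 2 <= J x.
  rewrite /J; have := le_trans (ler_norm _) (le_trans (Re_le_nrm _) (fM x)).
  by have := sqr_ge0 (nrm x - M); nra.
have Jinf : has_inf (range J).
  by split; [exists (J 0); exists 0 | exists (- M ^+ 2) => _ [x _ <-]].
pose m := inf (range J).
have Jm x : m <= J x by apply: ge_inf; [case: Jinf | exists x].
have /choice[u uJ] n : exists x, J x < m + (1 / 2 ^+ n) ^+ 2.
  have q0 : 0 < (1 / 2 ^+ n) ^+ 2 :> R by rewrite exprn_gt0 // divr_gt0 ?exprn_gt0.
  have [_ [x _ <-] ?] := inf_adherent q0 Jinf.
  by exists x.
have Jt x v (t : R) : J (x + t%:C *: v) =
    J x + t ^+ 2 * nrm v ^+ 2 + 2 * t * (complex.Re (hdot v x) - complex.Re (f v)).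
  rewrite /J sqr_nrmD Re_hdotZr nrmZr fD fZ raddfD /= ReZ exprMn real_normK ?num_real //.
  by rewrite (Re_hdotC x v); ring.
have uu n : nrm (u n.+1 - u n) <= 2 / 2 ^+ n.
  (* The midpoint of u n and u n.+1 cannot lie below the infimum m. *)
  have h := Jm (u n + (1/2)%:C *: (u n.+1 - u n)).
  have h1 := uJ n; have h2 := uJ n.+1.
  have e := Jt (u n) (u n.+1 - u n) 1.
  rewrite scale1r subrKC in e; rewrite Jt in h.
  have q0 : 0 < 1 / 2 ^+ n :> R by rewrite divr_gt0 ?exprn_gt0.
  have q1 : 1 / 2 ^+ n.+1 = (1 / 2 ^+ n) / 2 :> R.
    by rewrite exprS !div1r invfM mulrC.
  rewrite q1 in h2; have -> : 2 / 2 ^+ n = 2 * (1 / 2 ^+ n) :> R by rewrite div1r.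
  move: (1 / 2 ^+ n) (nrm _) (nrm_ge0 (u n.+1 - u n)) q0 h h1 h2 e => q d d0 q0 h h1 h2 e.
  by rewrite -(@ler_pXn2r _ 2) ?nnegrE //; [nra|lra].
have [l Hl] := geometric_series uu.
have zu n : nrm (l + u 0%N - u n) <= 4 / 2 ^+ n.
  have := Hl n; rewrite -(big_mkord xpredT (fun k => u k.+1 - u k)) telescope_sumr //.
  by rewrite opprB addrA; congr (nrm _ <= _ / _); lra.
exists (l + u 0%N) => v.
suff Re0 w : complex.Re (f w) = complex.Re (hdot w (l + u 0%N)).
  move: (Re0 v) (Re0 ('i *: v)); rewrite fZ hdotZl.
  case: (f v) (hdot v _) => [a b] [c d] /= -> h; congr (_ +i* _); lra.
apply/eqP; rewrite -subr_eq0 -normr_eq0 eq_le normr_ge0 andbT.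
apply: (@geometric_le0 _ (nrm w ^+ 2 + 1 + nrm w * 4)) => n.
have q0 : 0 < (2 ^+ n)^-1 :> R by rewrite invr_gt0 exprn_gt0.
have hz : `|complex.Re (hdot w (l + u 0%N)) - complex.Re (hdot w (u n))|
    <= nrm w * (4 / 2 ^+ n).
  rewrite -raddfB -hdotBr; apply: le_trans (Re_le_nrm _) _.
  by apply: le_trans (cauchy_schwarz _ _) _; rewrite ler_wpM2l ?nrm_ge0.
(* J cannot decrease much from u n to u n + t w and u n - t w, for t = 2^-n. *)
have jp := Jm (u n + (2 ^- n)%:C *: w); rewrite Jt in jp.
have jn := Jm (u n + (- 2 ^- n)%:C *: w); rewrite Jt in jn.
have ju := uJ n; rewrite div1r in ju.
move: (2 ^- n) q0 hz jp jn ju => q q0; rewrite !ler_norml => /andP[hz hz'] jp jn ju.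
apply/andP; split; nra.
Qed.


(** Working with adjoint pairs keeps the choice in [adjoint] out of the algebra;
    [adjointP] provides the pair. *)
Definition adj (T S : H -> H) := forall x y, hdot (T x) y = hdot x (S y).

Lemma hdot_inj y z : (forall x, hdot x y = hdot x z) -> y = z.
Proof.
move=> yz; apply/eqP; rewrite -subr_eq0; apply/eqP/nrm_le0.
have := nrm_hdot (y - z); rewrite hdotBr yz subrr => /esym/complexI/eqP.
by rewrite sqrf_eq0 => /eqP ->.
Qed.

Lemma adj_sym T S : adj T S -> adj S T.
Proof. by move=> TS x y; rewrite hdotC -TS -hdotC. Qed.

Lemma adj_uniq T S S' : adj T S -> adj T S' -> S = S'.
Proof.
by move=> TS TS'; apply/funext => y; apply: hdot_inj => x; rewrite -TS -TS'.
Qed.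

Lemma adj_linear T S : adj T S -> linear S.
Proof.
move=> TS c y z; apply: hdot_inj => x.
by rewrite -TS !hdotDr !hdotZr !TS.
Qed.

Lemma adj_bnd T S M : adj T S -> bnd T M -> bnd S M.
Proof.
move=> TS TM y; have [->|Sy0] := eqVneq (S y) 0.
  have [->|y0] := eqVneq y 0; first by rewrite !nrm0 mulr0.
  by rewrite nrm0 mulr_ge0 ?nrm_ge0 // (bnd_ge0 TM y0).
rewrite -(ler_pM2l (nrm_gt0 Sy0)).
have := cauchy_schwarz (T (S y)) y.
rewrite TS nrm_hdot nrm_real ger0_norm ?sqr_ge0 // expr2 => /le_trans; apply.
by rewrite mulrA ler_wpM2r ?nrm_ge0 // mulrC.
Qed.

Lemma adj_bounded T S : adj T S -> bounded_op T -> bounded_op S.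
Proof.
move=> TS /bounded_opP [_ [M M0 TM]]; apply/bounded_opP; split.
  exact: adj_linear TS.
by exists M => //; exact: adj_bnd TS TM.
Qed.

Lemma adjD T S T' S' : adj T S -> adj T' S' -> adj (T \+ T') (S \+ S').
Proof. by move=> TS TS' x y /=; rewrite hdotDl hdotDr TS TS'. Qed.

Lemma adjB T S T' S' : adj T S -> adj T' S' -> adj (T \- T') (S \- S').
Proof. by move=> TS TS' x y /=; rewrite hdotBl hdotBr TS TS'. Qed.

Lemma adjZ c T S : adj T S -> adj (c \*: T) (c^* \*: S).
Proof. by move=> TS x y /=; rewrite hdotZl hdotZr conjCK TS. Qed.

Lemma adj_comp T S T' S' : adj T S -> adj T' S' -> adj (T \o T') (S' \o S).
Proof. by move=> TS TS' x y /=; rewrite TS TS'. Qed.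

Lemma adj_id : adj idfun idfun. Proof. by []. Qed.

Lemma adjointP T : bounded_op T -> adj T (adjoint T).
Proof.
move=> /bounded_opP [linT [M M0 TM]] x y; rewrite /adjoint; case: xgetP.
  by move=> z -> ->.
have lTy : scalar (fun x => hdot (T x) y).
  by move=> c u v; rewrite linT hdotDl hdotZl.
have [|z hz] := @riesz (fun x => hdot (T x) y) (M * nrm y) lTy.
  move=> u; apply: le_trans (cauchy_schwarz _ _) _.
  by rewrite mulrAC ler_wpM2r ?nrm_ge0.
by move=> /(_ z hz).
Qed.

Lemma bounded_adjoint T : bounded_op T -> bounded_op (adjoint T).
Proof. by move=> bT; exact: adj_bounded (adjointP bT) bT. Qed.

Lemma bounded_id : @bounded_op R H idfun.
Proof.
apply/bounded_opP; split=> [c x y|] //.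
by exists 1 => // x; rewrite mul1r.
Qed.

Lemma bounded_add S T : bounded_op S -> bounded_op T -> bounded_op (S \+ T).
Proof.
move=> /bounded_opP[lS [M M0 SM]] /bounded_opP[lT [N N0 TN]].
apply/bounded_opP; split=> [c x y|]; first by rewrite /= lS lT scalerDr addrACA.
by exists (M + N); [rewrite addr_ge0|exact: bndD].
Qed.

Lemma bounded_scale c T : bounded_op T -> bounded_op (c \*: T).
Proof.
move=> /bounded_opP[lT [N N0 TN]].
apply/bounded_opP; split=> [b x y|].
  by rewrite /= lT scalerDr !scalerA mulrC.
exists (nrm c * N) => [|x /=]; first by rewrite mulr_ge0 ?nrm_ge0.
by rewrite nrmZ -mulrA ler_wpM2l ?nrm_ge0.
Qed.

Lemma bounded_comp S T : bounded_op S -> bounded_op T -> bounded_op (S \o T).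
Proof.
move=> /bounded_opP[lS [M M0 SM]] /bounded_opP[lT [N N0 TN]].
apply/bounded_opP; split=> [c x y|]; first by rewrite /= lT lS.
by exists (M * N); [rewrite mulr_ge0|exact: bnd_comp].
Qed.

Lemma opnorm_bnd T : bounded_op T -> bnd T (opnorm T).
Proof.
move=> /bounded_opP[lT [M M0 TM]] x.
have [->|x0] := eqVneq x 0; first by rewrite (lin0 lT) !nrm0 mulr0.
have nx0 := nrm_gt0 x0.
rewrite -ler_pdivrMr //; apply: ub_le_sup.
  exists M => _ [y y1 <-]; rewrite -/(nrm _).
  apply: le_trans (TM y) _; rewrite ler_piMr //.
  by move: y1; rewrite /= nrmE -(lecR _ 1).
exists (((nrm x)^-1)%:C *: x); last first.
  by rewrite (linZ lT) -/(nrm _) nrmZr ger0_norm ?invr_ge0 ?nrm_ge0 // mulrC.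
rewrite /= nrmE nrmZr ger0_norm ?invr_ge0 ?nrm_ge0 // mulVf ?gt_eqF //.
Qed.

Lemma opnorm_le T M : 0 <= M -> bnd T M -> opnorm T <= M.
Proof.
move=> M0 TM; apply: ge_sup.
  by exists (nrm (T 0)); exists 0; rewrite //= normr0.
move=> _ [y y1 <-]; rewrite -/(nrm _).
apply: le_trans (TM y) _; rewrite ler_piMr //.
by move: y1; rewrite /= nrmE -(lecR _ 1).
Qed.

(** Operators are summed pointwise; the sum of a geometrically dominated series
    is again dominated in operator norm. *)
Lemma op_series (T : nat -> H -> H) (C : R) :
  (forall n, bnd (T n) (C / 2 ^+ n)) ->
  exists S, forall n, bnd (fun x => S x - \sum_(k < n) T k x) (C * 2 / 2 ^+ n).
Proof.
move=> TC; have /choice[S HS] x : exists y, forall n,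
    nrm (y - \sum_(k < n) T k x) <= (C * 2 / 2 ^+ n) * nrm x.
  have [n|l Hl] := @geometric_series _ _ (fun k => T k x) (C * nrm x).
    by rewrite mulrAC; exact: TC.
  exists l => n; apply: le_trans (Hl n) _; rewrite le_eqVlt; apply/orP; left.
  by apply/eqP; ring.
by exists S => n x; exact: HS.
Qed.

(** Limits are taken along geometric rates, which is all that sums of series
    require. *)
Definition op_limit (X : set (H -> H)) : set (H -> H) :=
  [set T | exists C : R, forall n, exists2 S, X S & bnd (T \- S) (C / 2 ^+ n)].

Lemma op_limit_bounded T : op_limit (@bounded_op R H) T -> bounded_op T.
Proof.
move=> [C TC]; apply/bounded_opP; split.
  move=> c x y; apply/eqP; rewrite -subr_eq0; apply/eqP/nrm_le0.
  apply: (@geometric_le0 _ (C * nrm (c *: x + y) + (nrm c * (C * nrm x) + C * nrm y))) => n.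
  have [S /bounded_opP[lS _] TS] := TC n.
  have -> : T (c *: x + y) - (c *: T x + T y) = (T (c *: x + y) - S (c *: x + y))
     - (c *: (T x - S x) + (T y - S y)).
    by rewrite lS scalerBr addrACA -opprD opprB subrKA.
  apply: le_trans (nrmB _ _) _; rewrite mulrDl lerD //.
    by rewrite mulrAC; exact: TS.
  apply: le_trans (nrmD _ _) _; rewrite mulrDl lerD //.
    rewrite nrmZ -mulrA ler_wpM2l ?nrm_ge0 // mulrAC; exact: TS.
  by rewrite mulrAC; exact: TS.
have [S /bounded_opP[lS [M M0 SM]] TS] := TC 0%N.
exists (M + `|C|); first by rewrite addr_ge0.
move=> x; rewrite -[T x](subrK (S x)) addrC mulrDl.
apply: le_trans (nrmD _ _) _; apply: lerD => //.
apply: le_trans (TS x) _; rewrite expr0 divr1 ler_wpM2r ?nrm_ge0 //.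
exact: ler_norm.
Qed.

End HilbertSpace.

(** * Resolvents of selfadjoint elements *)

Section CStarAlgebra.
Local Open Scope complex_scope.
Context {R : realType} {A : cstarAlgType R}.
Implicit Types (a b c d e : A) (r : R).

Lemma amulDr a b c : amul c (a + b) = amul c a + amul c b.
Proof. exact: linearDr. Qed.
Lemma amulBl a b c : amul (a - b) c = amul a c - amul b c.
Proof. exact: linearBl. Qed.
Lemma amulBr a b c : amul c (a - b) = amul c a - amul c b.
Proof. exact: linearBr. Qed.
Lemma amulZl (k : R[i]) a b : amul (k *: a) b = k *: amul a b.
Proof. exact: linearZl_LR. Qed.
Lemma amulZr (k : R[i]) a b : amul a (k *: b) = k *: amul a b.
Proof. exact: linearZr_LR. Qed.
Lemma amul_sumr n (u : 'I_n -> A) a : amul a (\sum_k u k) = \sum_k amul a (u k).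
Proof. exact: linear_sumr. Qed.

Lemma nrm_amul a b : nrm (amul a b) <= nrm a * nrm b.
Proof. by rewrite -lecR rmorphM /= -!nrmE amul_norm. Qed.

Lemma starN a : star (- a) = - star a.
Proof. by rewrite -scaleN1r starZ rmorphN1 scaleN1r. Qed.
Lemma starB a b : star (a - b) = star a - star b.
Proof. by rewrite starD starN. Qed.

Lemma nrm_cstar a : nrm (amul (star a) a) = nrm a ^+ 2.
Proof. by apply: complexI; rewrite rmorphXn /= -!nrmE cstar_identity. Qed.

Lemma nrm_star a : nrm (star a) = nrm a.
Proof.
have le b : nrm b <= nrm (star b).
  have [->|b0] := eqVneq b 0; first by rewrite nrm0 nrm_ge0.
  rewrite -(ler_pM2r (nrm_gt0 b0)) -expr2 -nrm_cstar; exact: nrm_amul.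
by apply/eqP; rewrite eq_le le andbT -{2}(starK a) le.
Qed.

(** The Neumann series of [(1 - c)^-1 b], in a form that makes sense without a
    unit. *)
Lemma left_contraction b c : nrm c <= 1 / 2 -> exists x, x = b + amul c x.
Proof.
move=> c2; pose u n := iter n (amul c) b.
have uC n : nrm (u n) <= nrm b / 2 ^+ n.
  elim: n => [|n IH]; first by rewrite expr0 divr1.
  apply: le_trans (nrm_amul _ _) _; rewrite exprS invfM mulrCA.
  apply: ler_pM; rewrite ?nrm_ge0 //.
  by rewrite -div1r.
have [x xP] := geometric_series uC; exists x.
apply/eqP; rewrite -subr_eq0; apply/eqP/nrm_le0.
apply: (@geometric_le0 _ (nrm b * 2 + nrm b * 2)) => n.
have sS : \sum_(k < n.+1) u k = b + amul c (\sum_(k < n) u k).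
  by rewrite big_ord_recl amul_sumr.
have -> : x - (b + amul c x) =
    (x - \sum_(k < n.+1) u k) - amul c (x - \sum_(k < n) u k).
  by rewrite sS amulBr opprB !(opprD b) (addrA x) [in RHS](addrA x) subrKA.
apply: le_trans (nrmB _ _) _; rewrite mulrDl; apply: lerD.
  apply: le_trans (xP _) _; rewrite ler_wpM2l ?mulr_ge0 ?nrm_ge0 //.
  by rewrite exprS invfM ler_piMl ?invr_ge0 ?exprn_ge0 //; lra.
apply: le_trans (nrm_amul _ _) _.
have := xP n; have := nrm_ge0 c; have := nrm_ge0 (x - \sum_(k < n) u k).
nra.
Qed.

(** [resolvent d r e] says that [e = d (d + ir)^-1], in a form that makes sense
    without a unit. *)
Definition resolvent d r e := amul d e + (0 +i* r) *: e = d.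

(** Multiplying [d e + ir e = d] by [e^*] on the left and its adjoint by [e] on the
    right, and subtracting, gives [2 e^* e = e + e^*]; then [|e|^2 <= |e|] by the
    C*-identity. *)
Lemma resolvent_norm d r e : star d = d -> 0 < r -> resolvent d r e -> nrm e <= 1.
Proof.
move=> dd r0 de.
have ed : amul (star e) d - (0 +i* r) *: star e = d.
  rewrite -[RHS]dd -[in RHS]de starD starM dd starZ -scaleNr.
  by congr (_ + _ *: _); apply/eqP; rewrite eq_complex /= oppr0 !eqxx.
have E1 := congr1 (amul (star e)) de; have E2 := congr1 (amul^~ e) ed.
rewrite amulDr amulZr in E1; rewrite amulBl amulZl -amulA in E2.
set p := amul (star e) e in E1 E2; set k := 0 +i* r in de ed E1 E2.
have k0 : k != 0 by rewrite eq_complex /= eqxx gt_eqF.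
have : k *: (p + p) = k *: (star e + e).
  have -> : k *: (p + p) = amul (star e) d - amul d e.
    by rewrite scalerDr -E2 -E1 opprB [in RHS]addrC subrKA.
  rewrite -[amul (star e) d](subrK (k *: star e)) ed.
  by rewrite -[amul d e](addrK (k *: e)) de opprB addrC subrKA addrC scalerDr.
move=> /(scalerI k0) /(congr1 (@nrm R A)) pe.
have : nrm (p + p) <= nrm e + nrm e.
  by rewrite pe; apply: le_trans (nrmD _ _) _; rewrite nrm_star.
have -> : p + p = 2%:C *: p by rewrite rmorph_nat scaler_nat.
rewrite nrmZr /p nrm_cstar ger0_norm //.
by have := nrm_ge0 e; nra.
Qed.

(** A Neumann series gives the resolvent for [r >= 2 |d|]. It then extends from
    [3/2 s] to [s] as often as needed, because the bound [|e| <= 1] makes the step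
    a contraction whatever [s] is. *)
Lemma resolvent_exists d r : star d = d -> 0 < r -> exists e, resolvent d r e.
Proof.
move=> dd r0.
have base s : 0 < s -> nrm d * 2 <= s -> exists e, resolvent d s e.
  move=> s0 ds; have [|e eE] := @left_contraction ((0 -i* s^-1) *: d) ((0 +i* s^-1) *: d).
    rewrite nrmZ nrm_im gtr0_norm ?invr_gt0 // mulrC ler_pdivrMr //; lra.
  exists e; rewrite /resolvent {2}eE scalerDr amulZl !scalerA.
  have -> : (0 +i* s) * (0 -i* s^-1) = 1.
    by rewrite mul_im mulrN mulfV ?gt_eqF // opprK.
  have -> : (0 +i* s) * (0 +i* s^-1) = -1.
    by rewrite mul_im mulfV ?gt_eqF // rmorphN.
  by rewrite scale1r scaleN1r addrC subrK.
have step s : 0 < s -> (exists e, resolvent d (3 / 2 * s) e) -> exists e, resolvent d s e.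
  move=> s0 [e eP].
  have e1 : nrm e <= 1 by apply: resolvent_norm eP => //; lra.
  (* f = 3/2 e - 1/2 e f relates f = d (d + is)^-1 to e = d (d + 3/2 is)^-1. *)
  have [|f fE] := @left_contraction ((3/2)%:C *: e) ((- (1/2))%:C *: e).
    by rewrite nrmZr normrN ger0_norm; lra.
  have ef : amul e f = 3 *: e - 2 *: f.
    rewrite amulZl in fE; rewrite [in X in _ - X]fE scalerDr !scalerA.
    have -> : 2 * (3 / 2)%:C = 3 :> R[i].
      by apply/eqP; rewrite eq_complex /=; apply/andP; split; apply/eqP; field.
    have -> : 2 * (- (1 / 2))%:C = -1 :> R[i].
      by apply/eqP; rewrite eq_complex /=; apply/andP; split; apply/eqP; field.
    by rewrite opprD addrA subrr sub0r scaleN1r opprK.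
  set k := 0 +i* (3 / 2 * s) in eP.
  have k3 : 3 *: (amul d f + (0 +i* s) *: f) = 3 *: d.
    rewrite -[in RHS]eP !scalerDr !scalerA.
    have -> : 3 * (0 +i* s) = 2 * k :> R[i].
      by apply/eqP; rewrite eq_complex /=; apply/andP; split; apply/eqP; field.
    have h : amul d (amul e f) = amul d f - k *: amul e f.
      by rewrite amulA -[amul d e](addrK (k *: e)) eP amulBl amulZl.
    rewrite ef amulBr !amulZr in h.
    move/eqP: h; rewrite subr_eq => /eqP ->.
    rewrite scalerBr opprB !scalerA !(mulrC k) -/k [in RHS]addrAC.
    rewrite -(addrA (amul d f)) subrK [in RHS]addrAC.
    by rewrite -[X in _ = X + _ + _]scale1r -scalerDl.
  exists f; apply: (scalerI _ k3); by rewrite pnatr_eq0.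
have [N HN] := geometric_lt (nrm d * 2) r0.
elim: N r r0 HN => [|N IH] r r0 HN.
  by apply: base => //; move: HN; rewrite expr0 divr1; exact: ltW.
apply: (step) => //; apply: (step); first by lra.
apply: IH; first by lra.
move: HN; rewrite exprS invfM; lra.
Qed.

End CStarAlgebra.

(** * The range of a representation is norm closed *)

(** Dependent choice for the two successive approximations below. *)
Lemma iterate_step (U : Type) (P : nat -> U -> Prop) (Q : nat -> U -> U -> Prop)
    (x0 : U) :
  P 0%N x0 -> (forall n x, P n x -> exists2 y, P n.+1 y & Q n x y) ->
  exists u : nat -> U, [/\ u 0%N = x0, forall n, P n (u n)
                         & forall n, Q n (u n) (u n.+1)].
Proof.
move=> P0 step.
have /choice[g gP] (p : nat * U) : exists y, P p.1 p.2 -> P p.1.+1 y /\ Q p.1 p.2 y.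
  have [/step[y Py Qy]|nP] := pselect (P p.1 p.2); last by exists p.2 => /nP.
  by exists y.
pose u := fix u n := if n is k.+1 then g (k, u k) else x0.
have Pu n : P n (u n) by elim: n => [//|n IH]; have [] := gP (n, u n) IH.
by exists u; split=> // n; have [] := gP (n, u n) (Pu n).
Qed.

Section Representation.
Local Open Scope complex_scope.
Context {R : realType} {A : cstarAlgType R} {H : hilbertType R}.
Variable pi : A -> H -> H.
Hypothesis hpi : star_representation pi.
Implicit Types (a b d e : A) (x y : H) (T : H -> H).

Lemma rep_bounded a : bounded_op (pi a). Proof. by case: hpi. Qed.
Lemma rep_linear a : linear (pi a). Proof. by case: (rep_bounded a). Qed.
Lemma repM a b x : pi (amul a b) x = pi a (pi b x).
Proof. by case: hpi => _ _ -> _. Qed.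
Lemma rep_adj a : adj (pi a) (pi (star a)).
Proof. by case: hpi => _ _ _ h x y; exact: h. Qed.

Let lin_at x : linear (pi^~ x). Proof. by case: hpi. Qed.
Lemma repD a b x : pi (a + b) x = pi a x + pi b x. Proof. exact: linD (lin_at x) a b. Qed.
Lemma repB a b x : pi (a - b) x = pi a x - pi b x. Proof. exact: linB (lin_at x) a b. Qed.
Lemma repZ (k : R[i]) a x : pi (k *: a) x = k *: pi a x.
Proof. exact: linZ (lin_at x) k a. Qed.
Lemma rep_sum n (u : 'I_n -> A) x : pi (\sum_k u k) x = \sum_k pi (u k) x.
Proof. exact: (@lin_sum _ _ _ (pi^~ x) (lin_at x)). Qed.

(** If [q = |pi a|] exceeded [2 |a|], then [1 - d] with [d = a^* a / q^2] would
    be invertible, so [1 - pi d] would be bounded below by some [1 / K]; but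
    [|x - pi d x|^2 <= |x|^2 - |pi a x|^2 / q^2], which would improve the bound
    [q]. *)
Lemma rep_norm a : bnd (pi a) (2 * nrm a).
Proof.
set q := opnorm (pi a).
have aq : bnd (pi a) q by exact: opnorm_bnd (rep_bounded a).
suff: q <= 2 * nrm a by move/bnd_le; apply.
rewrite leNgt; apply/negP => qa.
have a0 := nrm_ge0 a; have q0 : 0 < q by apply: le_lt_trans qa; lra.
have aq' : bnd (pi (star a)) q by exact: adj_bnd (rep_adj a) aq.
pose d := (q ^- 2)%:C *: amul (star a) a.
have q2 : 0 < q ^- 2 by rewrite invr_gt0 exprn_gt0.
have dd : star d = d.
  by rewrite /d starZ starM starK; congr (_ *: _); apply/eqP; rewrite eq_complex /= oppr0 !eqxx.
have [|g gE] := @left_contraction _ _ d d.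
  rewrite nrmZr gtr0_norm // nrm_cstar mulrC ler_pdivrMr ?exprn_gt0 //; nra.
have gE' : star g = d + amul (star g) d by rewrite {1}gE starD starM dd.
have [_ [M M0 gM]] := (bounded_opP _).1 (rep_bounded (star g)).
pose K := 1 + M; have K1 : 1 <= K by rewrite /K; lra.
have lower x : nrm x <= K * nrm (x - pi d x).
  have {1}-> : x = (x - pi d x) + pi (star g) (x - pi d x).
    rewrite (linB (rep_linear _)) -repM.
    have -> : pi (star g) x = pi d x + pi (amul (star g) d) x by rewrite -repD -gE'.
    by rewrite addrK subrK.
  apply: le_trans (nrmD _ _) _; rewrite mulrDl mul1r lerD //; exact: gM.
have upper x : nrm (x - pi d x) ^+ 2 <= nrm x ^+ 2 - q ^- 2 * nrm (pi a x) ^+ 2.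
  have dx : pi d x = (q ^- 2)%:C *: pi (star a) (pi a x) by rewrite repZ repM.
  rewrite sqr_nrmD nrmN dx -scaleNr -rmorphN /= Re_hdotZr.
  rewrite Re_hdotC (adj_sym (rep_adj a)) nrm_hdot /=.
  rewrite nrmZr gtr0_norm // exprMn.
  have := aq' (pi a x).
  have := nrm_ge0 (pi (star a) (pi a x)); have := nrm_ge0 (pi a x).
  move: (nrm _) (nrm (pi (star a) _)) => s t s0 t0 ts.
  have : t ^+ 2 <= q ^+ 2 * s ^+ 2 by rewrite -exprMn ler_pXn2r ?nnegrE ?mulr_ge0 // ltW.
  rewrite -(ler_pM2l q2) [leRHS]mulrA mulVf ?mul1r => [h|]; last by rewrite gt_eqF ?exprn_gt0.
  have := ler_wpM2l (ltW q2) h; nra.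
have Kq : q <= q * Num.sqrt (1 - K ^- 2).
  apply: opnorm_le; first by rewrite mulr_ge0 ?sqrtr_ge0 // ltW.
  move=> x.
  have K2 : 0 <= 1 - K ^- 2 by rewrite subr_ge0 invf_le1 ?exprn_ege1 // exprn_gt0; lra.
  rewrite -(@ler_pXn2r _ 2) ?nnegrE ?mulr_ge0 ?nrm_ge0 ?sqrtr_ge0 ?(ltW q0) //.
  rewrite !exprMn sqr_sqrtr //.
  have l2 : nrm x ^+ 2 <= K ^+ 2 * nrm (x - pi d x) ^+ 2.
    by rewrite -exprMn ler_pXn2r ?nnegrE ?mulr_ge0 ?nrm_ge0 //; lra.
  have K0 : 0 < K ^+ 2 by rewrite exprn_gt0 //; lra.
  have := upper x; move: l2; rewrite -ler_pdivrMl // => l2 u2.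
  rewrite -(ler_pM2l q2).
  have -> : q ^- 2 * (q ^+ 2 * (1 - K ^- 2) * nrm x ^+ 2) =
      nrm x ^+ 2 - K ^- 2 * nrm x ^+ 2.
    by rewrite -[q ^+ 2 * _ * _]mulrA mulKf ?gt_eqF ?exprn_gt0 // mulrBl mul1r.
  lra.
have : Num.sqrt (1 - K ^- 2) < 1.
  rewrite -[ltRHS]sqrtr1 ltr_sqrt //.
  by rewrite gtrBl invr_gt0 exprn_gt0 //; lra.
by rewrite -(ltr_pM2l q0) mulr1 ltNge Kq.
Qed.

(** For [d = a^* a] and [r = 4 s^2] take [b = a - a e = ir a (d + ir)^-1]: then
    [b^* b = ir (e - e^* e)] bounds [b] whatever the size of [a], while [pi e] is
    small because [pi d] is small compared with [r]. *)
Lemma rep_truncate a (s : R) : 0 < s -> bnd (pi a) s ->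
  exists2 b, nrm b <= 3 * s & bnd (pi a \- pi b) (s / 3).
Proof.
move=> s0 as_; pose d := amul (star a) a.
have dd : star d = d by rewrite /d starM starK.
have r0 : 0 < 4 * s ^+ 2 by rewrite mulr_gt0 ?exprn_gt0.
have [e eP] := resolvent_exists dd r0; have e1 := resolvent_norm dd r0 eP.
rewrite /resolvent in eP; set k := 0 +i* _ in eP.
have nk : nrm k = 4 * s ^+ 2 by rewrite nrm_im gtr0_norm.
exists (a - amul a e).
  have ke : k *: e = d - amul d e by rewrite -{1}eP addrC addKr.
  have bb : amul (star (a - amul a e)) (a - amul a e) = k *: (e - amul (star e) e).
    rewrite starB starM scalerBr -amulZr ke amulBl !amulBr -!amulA.
    by rewrite (amulA (star a) a) -/d.
  rewrite -(@ler_pXn2r _ 2) ?nnegrE ?nrm_ge0 //; last by lra.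
  rewrite -nrm_cstar bb nrmZ nk.
  have N2 : nrm (e - amul (star e) e) <= 2.
    have := nrmB e (amul (star e) e); rewrite nrm_cstar.
    by have := nrm_ge0 e; nra.
  by have := ler_wpM2l (ltW r0) N2; have := sqr_ge0 s; lra.
move=> x; rewrite /= repB opprB addrC subrK repM.
have ds y : nrm (pi d y) <= s ^+ 2 * nrm y.
  rewrite /d repM expr2 -mulrA; apply: le_trans (adj_bnd (rep_adj a) as_ _) _.
  by rewrite ler_pM2l.
have kE : k *: pi e x = pi d x - pi d (pi e x).
  by rewrite -{1}eP repD repM repZ addrC addKr.
have := nrmB (pi d x) (pi d (pi e x)); rewrite -kE nrmZ nk.
have := ds x; have := ds (pi e x); have := as_ (pi e x).
have := nrm_ge0 (pi e x); have := nrm_ge0 x.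
move: (nrm (pi e x)) (nrm x) (nrm (pi a _)) => u v w v0 u0 h1 h2 h3 h4.
have s2 : 0 < s ^+ 2 by rewrite exprn_gt0.
have : 3 * u <= v by rewrite -(ler_pM2l s2); lra.
nra.
Qed.

(** Truncation brings any limit [T] of the range, with bound [s], within [s / 2] of
    the image of an element of norm at most [4 s]. Iterating, [T] is the image of
    the sum of these elements. *)
Lemma rep_range_closed : op_limit (range pi) `<=` range pi.
Proof.
move=> T [C TC].
pose cl S := forall e : R, 0 < e -> exists a, bnd (S \- pi a) e.
have clT : cl T.
  move=> e e0; have [N HN] := geometric_lt C e0.
  have [_ [a _ <-] aT] := TC N; exists a; exact: bnd_le (ltW HN) aT.
have [M M0 TM] : exists2 M, 0 < M & bnd T M.
  have [a aT] := clT 1 ltr01.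
  have [_ [N N0 aN]] := (bounded_opP _).1 (rep_bounded a).
  exists (1 + N); first by lra.
  by move=> x; rewrite -[T x](subrK (pi a x)); exact: (bndD aT aN).
pose P n S := cl S /\ bnd S (M / 2 ^+ n).
pose Q n S S' := exists2 b, nrm b <= 4 * M / 2 ^+ n & forall x, S' x = S x - pi b x.
have [] := @iterate_step _ P Q T.
- by split=> //; rewrite expr0 divr1.
- move=> n S [clS Sn].
  set s := M / 2 ^+ n in Sn.
  have s0 : 0 < s by rewrite divr_gt0 ?exprn_gt0.
  have [|a aS] := clS (s / 12); first by lra.
  have [||b bs ab] := @rep_truncate a (13 / 12 * s); first by lra.
    move=> x; have -> : pi a x = S x - (S x - pi a x) by rewrite opprB addrC subrK.
    have := bndB Sn aS x => /= h; apply: le_trans h _.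
    by rewrite ler_wpM2r ?nrm_ge0 //; lra.
  exists (S \- pi b); last by exists b => //; rewrite -mulrA -/s; lra.
  split.
    move=> e e0; have [c cS] := clS e e0; exists (c - b) => x /=.
    by rewrite repB opprB addrA subrK; exact: cS.
  have -> : M / 2 ^+ n.+1 = s / 2 by rewrite exprS invfM mulrCA mulrC.
  move=> x /=; rewrite -(subrKA (pi a x)).
  have := bndD aS ab x => /= h; apply: le_trans h _.
  by rewrite ler_wpM2r ?nrm_ge0 //; lra.
move=> u [u0 uP uQ].
have /choice[b bP] n : exists b, nrm b <= 4 * M / 2 ^+ n /\
    forall x, u n.+1 x = u n x - pi b x by have [b] := uQ n; exists b.
have [c cb] := geometric_series (fun n => (bP n).1).
exists c => //; apply/funext => x; apply/eqP; rewrite eq_sym -subr_eq0; apply/eqP/nrm_le0.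
apply: (@geometric_le0 _ (M * nrm x + 2 * (4 * M * 2) * nrm x)) => n.
have un : u n x = T x - pi (\sum_(k < n) b k) x.
  rewrite rep_sum; elim: n => [|n IH]; first by rewrite big_ord0 subr0 u0.
  by rewrite big_ord_recr /= opprD addrA -IH (bP n).2.
have -> : T x - pi c x = u n x - pi (c - \sum_(k < n) b k) x.
  by rewrite un repB opprB addrA subrK.
apply: le_trans (nrmB _ _) _; rewrite mulrDl lerD //.
  by rewrite mulrAC; exact: (uP n).2.
apply: le_trans (rep_norm _ _) _.
by have := cb n; have := nrm_ge0 x; nra.
Qed.

End Representation.

(** * Multipliers *)

Section Multipliers.
Local Open Scope complex_scope.
Context {R : realType} {A : cstarAlgType R} {H : hilbertType R}.
Variable pi : A -> H -> H.
Hypothesis hpi : star_representation pi.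
Implicit Types (a b : A) (x y : H) (S T X Z : H -> H).

Lemma range_add S T : range pi S -> range pi T -> range pi (S \+ T).
Proof.
move=> [a _ <-] [b _ <-]; exists (a + b) => //.
by apply/funext => x; rewrite (repD hpi).
Qed.

Lemma range_scale c T : range pi T -> range pi (c \*: T).
Proof.
by move=> [a _ <-]; exists (c *: a) => //; apply/funext => x; rewrite (repZ hpi).
Qed.

Lemma range_comp a b : range pi (pi a \o pi b).
Proof. by exists (amul a b) => //; apply/funext => x; rewrite (repM hpi). Qed.

Lemma range_adj S T : adj T S -> range pi T -> range pi S.
Proof.
move=> TS [a _ aT]; exists (star a) => //.
by apply: adj_uniq TS; rewrite -aT; exact: rep_adj.
Qed.

Lemma env_bounded T : enveloping pi T -> bounded_op T. Proof. by case. Qed.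

Lemma env_comm S T x :
  enveloping pi T -> commutant (range pi) S -> T (S x) = S (T x).
Proof. by move=> [_ TS] cS; exact: (congr1 (@^~ x) (TS S cS)). Qed.

Lemma comm_linear S : commutant (range pi) S -> linear S.
Proof. by move=> [[]]. Qed.

Lemma env_id : enveloping pi idfun.
Proof. by split; first exact: bounded_id. Qed.

Lemma env_add S T : enveloping pi S -> enveloping pi T -> enveloping pi (S \+ T).
Proof.
move=> eS eT; split; first by apply: bounded_add; exact: env_bounded.
move=> U cU; apply/funext => x /=.
by rewrite (env_comm _ eS cU) (env_comm _ eT cU) (linD (comm_linear cU)).
Qed.

Lemma env_scale c T : enveloping pi T -> enveloping pi (c \*: T).
Proof.
move=> eT; split; first by apply: bounded_scale; exact: env_bounded.
move=> U cU; apply/funext => x /=.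
by rewrite (env_comm _ eT cU) (linZ (comm_linear cU)).
Qed.

Lemma env_comp S T : enveloping pi S -> enveloping pi T -> enveloping pi (S \o T).
Proof.
move=> eS eT; split; first by apply: bounded_comp; exact: env_bounded.
move=> U cU; apply/funext => x /=.
by rewrite (env_comm _ eT cU) (env_comm _ eS cU).
Qed.

Lemma comm_adjoint S : commutant (range pi) S -> commutant (range pi) (adjoint S).
Proof.
move=> [bS cS]; split; first exact: bounded_adjoint.
move=> _ [a _ <-]; have SS := adjointP bS.
have aa : adj (pi (star a)) (pi a) by exact: adj_sym (rep_adj hpi a).
apply: adj_uniq (adj_comp aa SS) _.
rewrite -cS; last by exists (star a).
exact: adj_comp.
Qed.

Lemma env_adj S T : adj T S -> enveloping pi T -> enveloping pi S.
Proof.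
move=> TS eT; split; first exact: adj_bounded TS (env_bounded eT).
move=> U cU; have cU' := comm_adjoint cU.
have UU : adj (adjoint U) U by apply: adj_sym; apply: adjointP; case: cU.
apply: adj_uniq (adj_comp UU TS) _.
have -> : adjoint U \o T = T \o adjoint U.
  by apply/funext => x /=; rewrite (env_comm _ eT cU').
exact: adj_comp.
Qed.

Lemma env_limit T : op_limit (enveloping pi) T -> enveloping pi T.
Proof.
move=> [C TC]; split.
  apply: op_limit_bounded; exists C => n; have [S eS ST] := TC n.
  by exists S => //; exact: env_bounded.
move=> U cU; apply/funext => x /=; apply/eqP; rewrite -subr_eq0; apply/eqP/nrm_le0.
have [_ [M M0 UM]] := (bounded_opP _).1 cU.1.
apply: (@geometric_le0 _ (C * nrm (U x) + M * (C * nrm x))) => n.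
have [S eS ST] := TC n.
have -> : T (U x) - U (T x) = (T (U x) - S (U x)) - U (T x - S x).
  by rewrite (linB (comm_linear cU)) (env_comm _ eS cU) opprB subrKA.
apply: le_trans (nrmB _ _) _; rewrite mulrDl lerD //.
  by rewrite mulrAC; exact: ST.
apply: le_trans (UM _) _; rewrite -mulrA ler_wpM2l // mulrAC; exact: ST.
Qed.

Lemma LM_id : LM pi idfun.
Proof. by split=> [|a]; [exact: env_id | exists a]. Qed.

Lemma LM_add S T : LM pi S -> LM pi T -> LM pi (S \+ T).
Proof.
move=> [eS Sa] [eT Ta]; split=> [|a]; first exact: env_add.
exact: (range_add (Sa a) (Ta a)).
Qed.

Lemma LM_scale c T : LM pi T -> LM pi (c \*: T).
Proof.
move=> [eT Ta]; split=> [|a]; first exact: env_scale.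
exact: (range_scale c (Ta a)).
Qed.

Lemma LM_comp S T : LM pi S -> LM pi T -> LM pi (S \o T).
Proof.
move=> [eS Sa] [eT Ta]; split=> [|a]; first exact: env_comp.
by have [b _ bT] := Ta a; rewrite -compA -bT; exact: Sa.
Qed.

Lemma LM_limit T : op_limit (LM pi) T -> LM pi T.
Proof.
move=> [C TC]; split.
  by apply: env_limit; exists C => n; have [S [eS _]] := TC n; exists S.
move=> a; apply: (rep_range_closed hpi).
exists (C * (2 * nrm a)) => n; have [S [_ Sa] TS] := TC n; exists (S \o pi a) => // x.
have [->|x0] := eqVneq x 0.
  by apply: le_trans (TS _) _; rewrite (lin0 (rep_linear hpi a)) nrm0 !mulr0.
apply: le_trans (TS _) _; rewrite [C * _ / _]mulrAC -[leRHS]mulrA.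
by apply: ler_wpM2l (rep_norm hpi a x); exact: bnd_ge0 TS x0.
Qed.

Lemma RM_add S T : RM pi S -> RM pi T -> RM pi (S \+ T).
Proof.
move=> [eS Sa] [eT Ta]; split=> [|a]; first exact: env_add.
have -> : pi a \o (S \+ T) = (pi a \o S) \+ (pi a \o T).
  by apply/funext => x /=; rewrite (linD (rep_linear hpi a)).
exact: (range_add (Sa a) (Ta a)).
Qed.

Lemma RM_scale c T : RM pi T -> RM pi (c \*: T).
Proof.
move=> [eT Ta]; split=> [|a]; first exact: env_scale.
have -> : pi a \o (c \*: T) = c \*: (pi a \o T).
  by apply/funext => x /=; rewrite (linZ (rep_linear hpi a)).
exact: (range_scale c (Ta a)).
Qed.

Lemma LM_adj S T : adj T S -> LM pi T -> RM pi S.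
Proof.
move=> TS [eT Ta]; split=> [|a]; first exact: env_adj TS eT.
apply: range_adj (Ta (star a)); apply: adj_comp TS _.
exact: adj_sym (rep_adj hpi a).
Qed.

Lemma RM_limit T : op_limit (RM pi) T -> RM pi T.
Proof.
move=> [C TC]; split.
  by apply: env_limit; exists C => n; have [S [eS _]] := TC n; exists S.
move=> a; apply: (rep_range_closed hpi).
exists ((2 * nrm a) * C) => n; have [S [_ Sa] TS] := TC n; exists (pi a \o S) => // x.
rewrite /= -(linB (rep_linear hpi a)); apply: le_trans (rep_norm hpi _ _) _.
by rewrite -!mulrA; do 2?(rewrite ler_wpM2l ?nrm_ge0 //); rewrite mulrA; exact: TS.
Qed.

Lemma QM_add S T : QM pi S -> QM pi T -> QM pi (S \+ T).
Proof.
move=> [eS Sa] [eT Ta]; split=> [|a b]; first exact: env_add.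
have -> : pi a \o (S \+ T) \o pi b = (pi a \o S \o pi b) \+ (pi a \o T \o pi b).
  by apply/funext => x /=; rewrite (linD (rep_linear hpi a)).
exact: (range_add (Sa a b) (Ta a b)).
Qed.

Lemma QM_scale c T : QM pi T -> QM pi (c \*: T).
Proof.
move=> [eT Ta]; split=> [|a b]; first exact: env_scale.
have -> : pi a \o (c \*: T) \o pi b = c \*: (pi a \o T \o pi b).
  by apply/funext => x /=; rewrite (linZ (rep_linear hpi a)).
exact: (range_scale c (Ta a b)).
Qed.

Lemma QM_adj S T : adj T S -> QM pi T -> QM pi S.
Proof.
move=> TS [eT Ta]; split=> [|a b]; first exact: env_adj TS eT.
apply: range_adj (Ta (star b) (star a)).
have h c : adj (pi (star c)) (pi c) by exact: adj_sym (rep_adj hpi c).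
by rewrite -compA; apply: adj_comp (h b) (adj_comp TS (h a)).
Qed.

Lemma LM_QM T : LM pi T -> QM pi T.
Proof.
move=> [eT Ta]; split=> // a b; have [c _ cT] := Ta b.
by rewrite -compA -cT; exact: range_comp.
Qed.

Lemma RM_QM T : RM pi T -> QM pi T.
Proof.
move=> [eT Ta]; split=> // a b; have [c _ cT] := Ta a.
by rewrite -cT; exact: range_comp.
Qed.

Lemma QM_LM_comp X T : QM pi X -> LM pi T -> QM pi (X \o T).
Proof.
move=> [eX Xa] [eT Ta]; split=> [|a b]; first exact: env_comp.
have -> : pi a \o (X \o T) \o pi b = pi a \o X \o (T \o pi b) by [].
by have [c _ <-] := Ta b; exact: Xa.
Qed.

Lemma closed_series (P : set (H -> H)) (T : nat -> H -> H) (C : R) :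
  P (fun=> 0) -> (forall S S', P S -> P S' -> P (S \+ S')) ->
  (forall S, op_limit P S -> P S) ->
  (forall n, P (T n)) -> (forall n, bnd (T n) (C / 2 ^+ n)) ->
  exists2 S, P S &
    forall n, bnd (fun x => S x - \sum_(k < n) T k x) (C * 2 / 2 ^+ n).
Proof.
move=> P0 PD Plim PT TC; have [S ST] := op_series TC; exists S => //.
apply: Plim; exists (C * 2) => n; exists (fun x => \sum_(k < n) T k x); last exact: ST.
elim: n => [|n IH].
  by rewrite (_ : (fun _ => _) = fun=> 0) //; apply/funext => x; rewrite big_ord0.
rewrite (_ : (fun _ => _) = (fun x => \sum_(k < n) T k x) \+ T n); first exact: PD.
by apply/funext => x; rewrite big_ord_recr.
Qed.

Lemma LM0 : LM pi (fun=> 0).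
Proof.
rewrite (_ : (fun=> 0) = 0 \*: idfun); first exact: LM_scale LM_id.
by apply/funext => x /=; rewrite scale0r.
Qed.

Lemma RM0 : RM pi (fun=> 0).
Proof. by apply: LM_adj LM0 => x y; rewrite /hdot linear0l linear0r. Qed.

(** Here [1 + Z] is the inverse of [T], obtained as a Neumann series. *)
Lemma LM_neumann T : LM pi T -> bnd (T \- idfun) (1 / 8) ->
  exists Z, [/\ LM pi Z, bnd Z (1 / 4) & forall x, T (x + Z x) = x].
Proof.
move=> LT T8; pose N : H -> H := idfun \+ (-1) \*: T.
have LN : LM pi N by apply: LM_add LM_id (LM_scale _ LT).
have TN x : T x = x - N x by rewrite /N /= scaleN1r opprB subrKC.
have N8 : bnd N (1 / 8).
  by move=> x; rewrite /N /= scaleN1r -nrmN opprB; exact: T8.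
have lN : linear N by case: (env_bounded LN.1).
pose u n := iter n (fun S => N \o S) N.
have uC n : bnd (u n) (1 / 8 / 2 ^+ n).
  elim: n => [|n IH]; first by rewrite expr0 divr1.
  have N2 : bnd N (1 / 2) by apply: bnd_le N8; lra.
  have -> : 1 / 8 / 2 ^+ n.+1 = (1 / 2) * (1 / 8 / 2 ^+ n) :> R.
    by rewrite exprS invfM; ring.
  by apply: bnd_comp N2 IH; lra.
have Lu n : LM pi (u n) by elim: n => [//|n IH]; exact: LM_comp LN IH.
have [Z LZ ZP] := closed_series LM0 LM_add LM_limit Lu uC.
exists Z; split=> //.
  move=> x; have := ZP 0%N x; rewrite big_ord0 subr0 expr0 => h.
  by apply: le_trans h _; rewrite ler_wpM2r ?nrm_ge0 //; lra.
move=> x; suff ZE : Z x = N (x + Z x) by rewrite TN -ZE addrK.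
apply/eqP; rewrite -subr_eq0; apply/eqP/nrm_le0.
apply: (@geometric_le0 _ (nrm x)) => n.
have sS : \sum_(k < n.+1) u k x = N (x + \sum_(k < n) u k x).
  by rewrite big_ord_recl (linD lN) (lin_sum lN).
have -> : Z x - N (x + Z x) =
    (Z x - \sum_(k < n.+1) u k x) - N (Z x - \sum_(k < n) u k x).
  by rewrite sS -[RHS]addrA -opprD -(linD lN) -(addrA x) subrKC.
apply: le_trans (nrmB _ _) _.
have h1 := ZP n.+1 x; rewrite exprS invfM in h1.
have h2 := le_trans (N8 _) (ler_wpM2l _ (ZP n x)).
apply: le_trans (lerD h1 (h2 _)) _; first by lra.
have : 0 <= nrm x / 2 ^+ n by rewrite divr_ge0 ?nrm_ge0 ?exprn_ge0.
lra.
Qed.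

End Multipliers.

(** * Splitting a quasi-multiplier up to a small remainder *)

Section Splitting.
Local Open Scope complex_scope.
Context {R : realType} {A : cstarAlgType R} {H : hilbertType R}.
Variable pi : A -> H -> H.
Hypothesis hpi : star_representation pi.
Implicit Types (x y : H) (S T X : H -> H) (c t : R).

(** The parameter [c] controls the two multipliers and [t] the remainder. *)
Definition splits X c t := exists S T Y,
  [/\ LM pi S /\ bnd S c, RM pi T /\ bnd T c, QM pi Y /\ bnd Y t
    & forall x, X x = S x + T x + Y x].

Lemma splits_add X1 X2 c1 c2 t1 t2 :
  splits X1 c1 t1 -> splits X2 c2 t2 -> splits (X1 \+ X2) (c1 + c2) (t1 + t2).
Proof.
move=> [S1 [T1 [Y1 [[LS1 bS1] [RT1 bT1] [QY1 bY1] E1]]]].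
move=> [S2 [T2 [Y2 [[LS2 bS2] [RT2 bT2] [QY2 bY2] E2]]]].
exists (S1 \+ S2), (T1 \+ T2), (Y1 \+ Y2); split; try split.
- exact: LM_add.
- exact: bndD.
- exact: RM_add.
- exact: bndD.
- exact: QM_add.
- exact: bndD.
- by move=> x /=; rewrite E1 E2 addrACA (addrACA (S1 x)).
Qed.

Lemma splits_scale (k : R[i]) X c t :
  splits X c t -> splits (k \*: X) (nrm k * c) (nrm k * t).
Proof.
move=> [S [T [Y [[LS bS] [RT bT] [QY bY] E]]]].
exists (k \*: S), (k \*: T), (k \*: Y); split; try split; try exact: bndZ.
- exact: LM_scale.
- exact: RM_scale.
- exact: QM_scale.
- by move=> x /=; rewrite E !scalerDr.
Qed.

Variable delta : R.
Hypothesis delta_gt0 : 0 < delta.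
Hypothesis factor : forall h, QM pi h ->
  op_le (scalar_op (1 - delta)) h -> op_le h (scalar_op (1 + delta)) ->
  exists T, [/\ LM pi T, opnorm (T \- idfun) < 1 / 8 & adjoint T \o T = h].

Lemma selfadjoint_form X : adj X X -> bnd X delta ->
  forall x, exists2 r : R, hdot (X x) x = r%:C & `|r| <= delta * nrm x ^+ 2.
Proof.
move=> XX Xd x; exists (complex.Re (hdot (X x) x)).
  have := hdotC (X x) x; rewrite -XX; case: (hdot _ _) => a b [] hb.
  by congr (_ +i* _) => /=; lra.
apply: le_trans (Re_le_nrm _) _; apply: le_trans (cauchy_schwarz _ _) _.
by rewrite expr2 mulrA ler_wpM2r ?nrm_ge0.
Qed.

(** From [T^* T = 1 + X] and [G = 1 + Z = T^-1] one gets [T^* = (1 + X) G], that is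
    [X = - Z + (T^* - 1) - X Z]: the first two terms are left and right
    multipliers, and the last one is small relative to [X] because [Z] is small. *)
Lemma splits_unit X : QM pi X -> adj X X -> bnd X delta -> splits X 1 (delta / 4).
Proof.
move=> QX XX Xd.
have scal c t x : t%:C *: x + X x - c%:C *: x = X x + (t - c)%:C *: x.
  by rewrite rmorphB scalerBl addrAC addrC.
have [|x|x|T [LT T1 TT]] := factor (h := idfun \+ X).
- by apply: QM_add => //; exact: LM_QM (LM_id _).
- rewrite /scalar_op /= -[X in X + _ - _]scale1r -(rmorph1 (real_complex R)) scal.
  have [r rE rle] := selfadjoint_form XX Xd x.
  rewrite hdotDl hdotZl rE nrm_hdot -rmorphM -rmorphD ler0c /=.
  by move: rle; rewrite ler_norml => /andP[]; lra.
- rewrite /scalar_op /=.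
  have -> : (1 + delta)%:C *: x - (x + X x) = delta%:C *: x - X x.
    by rewrite rmorphD scalerDl scale1r opprD addrA (addrAC x) subrr add0r.
  have [r rE rle] := selfadjoint_form XX Xd x.
  rewrite hdotBl hdotZl rE nrm_hdot -rmorphM -rmorphB ler0c /=.
  by move: rle; rewrite ler_norml => /andP[]; lra.
have bT := env_bounded LT.1; have adT := adjointP bT.
have T8 : bnd (T \- idfun) (1 / 8).
  apply: bnd_le (ltW T1) _; apply: opnorm_bnd.
  have -> : T \- idfun = T \+ (-1) \*: idfun.
    by apply/funext => x /=; rewrite scaleN1r.
  by apply: bounded_add bT _; apply: bounded_scale; exact: bounded_id.
have [Z [LZ Z4 TZ]] := LM_neumann hpi LT T8.
have N1 : nrm (-1 : R[i]) = 1 by rewrite nrmN /nrm normr1.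
exists ((-1) \*: Z), (adjoint T \+ (-1) \*: idfun), ((-1) \*: (X \o Z)).
split; try split.
- exact: LM_scale.
- by apply: bnd_le (bndZ (-1) Z4); rewrite N1; lra.
- apply: RM_add => //; first exact: LM_adj adT LT.
  by apply: RM_scale => //; exact: LM_adj adj_id (LM_id _).
- have -> : adjoint T \+ (-1) \*: idfun = adjoint T \- idfun.
    by apply/funext => x /=; rewrite scaleN1r.
  by apply: bnd_le (adj_bnd (adjB adT adj_id) T8); lra.
- by apply: QM_scale => //; exact: QM_LM_comp.
- apply: bnd_le (bndZ (-1) (bnd_comp (ltW delta_gt0) Xd Z4)); rewrite N1; lra.
- move=> x; have := congr1 (@^~ (x + Z x)) TT; rewrite /= TZ => ->.
  have [[linX _] _] := QX.1.
  rewrite !scaleN1r (linD linX) -[x + Z x + _]addrA (addrC x) addrK addKr.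
  by rewrite addrK.
Qed.

(** Rescaling [X] to bound [delta] makes the bounds proportional to [s]; this is
    what lets the series of [QM_sum] converge. *)
Lemma splits_selfadjoint X s : 0 < s -> QM pi X -> adj X X -> bnd X s ->
  splits X (s / delta) (s / 4).
Proof.
move=> s0 QX XX Xs.
have k0 : 0 < delta / s by rewrite divr_gt0.
have kn : nrm ((delta / s)%:C : R[i]) = delta / s by rewrite nrm_real gtr0_norm.
have : splits ((delta / s)%:C \*: X) 1 (delta / 4).
  apply: splits_unit; first exact: QM_scale.
    by move=> x y /=; rewrite hdotZl hdotZr XX; congr (_ * _); exact/esym/conjc_real.
  by have := bndZ (delta / s)%:C Xs; rewrite kn divfK // gt_eqF.
move=> /(splits_scale (s / delta)%:C).
have -> : (s / delta)%:C \*: ((delta / s)%:C \*: X) = X.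
  apply/funext => x /=; rewrite scalerA -rmorphM /= mulf_div.
  by rewrite (mulrC s) divff ?scale1r // mulf_neq0 ?gt_eqF.
rewrite nrm_real gtr0_norm ?divr_gt0 // mulr1.
by congr splits; field; rewrite gt_eqF.
Qed.

Lemma splits_general X s : 0 < s -> QM pi X -> bnd X s ->
  splits X (2 * (s / delta)) (s / 2).
Proof.
move=> s0 QX Xs; have aX := adjointP (env_bounded QX.1).
set X' := adjoint X in aX.
have QX' : QM pi X' by exact: QM_adj aX QX.
have X's : bnd X' s by exact: adj_bnd aX Xs.
pose X1 := (1 / 2)%:C \*: (X \+ X').
pose X2 := (1 / 2)%:C \*: ((0 -i* 1) \*: X \+ (0 +i* 1) \*: X').
have s1 : splits X1 (s / delta) (s / 4).
  apply: splits_selfadjoint => //.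
  - by apply: QM_scale => //; exact: QM_add.
  - move=> x y; rewrite (adjZ (1 / 2)%:C (adjD aX (adj_sym aX))) /= addrC.
    by congr (hdot _ (_ *: _)); apply/eqP; rewrite eq_complex /= oppr0 !eqxx.
  - have := bndZ (1 / 2)%:C (bndD Xs X's); apply: bnd_le.
    by rewrite nrm_real ger0_norm; lra.
have s2 : splits X2 (s / delta) (s / 4).
  apply: splits_selfadjoint => //.
  - by apply: QM_scale => //; apply: QM_add => //; exact: QM_scale.
  - move=> x y; rewrite (adjZ (1 / 2)%:C (adjD (adjZ _ aX) (adjZ _ (adj_sym aX)))) /= addrC.
    by congr (hdot _ (_ *: (_ *: _ + _ *: _))); apply/eqP;
      rewrite eq_complex /= ?opprK ?oppr0 !eqxx.
  - have := bndZ (1 / 2)%:C (bndD (bndZ (0 -i* 1) Xs) (bndZ (0 +i* 1) X's)).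
    by apply: bnd_le; rewrite !nrm_im normrN normr1 nrm_real ger0_norm; lra.
have := splits_add s1 (splits_scale (0 +i* 1) s2).
rewrite nrm_im normr1 !mul1r.
have -> : X1 \+ (0 +i* 1) \*: X2 = X.
  apply/funext => x; rewrite /X1 /X2 /= !(scalerDr, scalerA) addrACA -!scalerDl.
  have -> : (1 / 2)%:C + (0 +i* 1) * (1 / 2)%:C * (0 -i* 1) = 1 :> R[i].
    by apply/eqP; rewrite eq_complex /=; apply/andP; split; apply/eqP; lra.
  have -> : (1 / 2)%:C + (0 +i* 1) * (1 / 2)%:C * (0 +i* 1) = 0 :> R[i].
    by apply/eqP; rewrite eq_complex /=; apply/andP; split; apply/eqP; lra.
  by rewrite scale1r scale0r addr0.
by congr splits; lra.
Qed.

(** Splitting the remainder again and again sums up to an exact decomposition. *)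
Lemma QM_sum X : QM pi X -> exists S T, [/\ LM pi S, RM pi T & X = S \+ T].
Proof.
move=> QX; have [_ [M0 M00 XM0]] := (bounded_opP _).1 (env_bounded QX.1).
pose M := M0 + 1; have M1 : 0 < M by rewrite /M; lra.
have XM : bnd X M by apply: bnd_le XM0; rewrite /M; lra.
pose K := 2 * (M / delta).
pose P n Y := QM pi Y /\ bnd Y (M / 2 ^+ n).
pose Q n Y Y' := exists S T, [/\ LM pi S /\ bnd S (K / 2 ^+ n),
  RM pi T /\ bnd T (K / 2 ^+ n) & forall x, Y' x = Y x - (S x + T x)].
have [||u [u0 uP uQ]] := @iterate_step _ P Q X.
- by split=> //; rewrite expr0 divr1.
- move=> n Y [QY Yn].
  have sn : 0 < M / 2 ^+ n by rewrite divr_gt0 ?exprn_gt0.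
  have [S [T [Y' [LS RT [QY' bY'] E]]]] := splits_general sn QY Yn.
  exists Y'; first by split=> //; rewrite exprSr invfM mulrA.
  exists S, T; have -> : K / 2 ^+ n = 2 * (M / 2 ^+ n / delta) by rewrite /K; ring.
  by split=> // x; rewrite E addrC addKr.
have /choice[S] n : exists S, exists T, [/\ LM pi S /\ bnd S (K / 2 ^+ n),
  RM pi T /\ bnd T (K / 2 ^+ n) & forall x, u n.+1 x = u n x - (S x + T x)] by exact: uQ.
move=> /choice[T STP].
have [S0 LS0 S0P] := closed_series (LM0 hpi) (LM_add hpi) (@LM_limit _ _ _ _ hpi)
  (fun n => let: And3 (conj h _) _ _ := STP n in h)
  (fun n => let: And3 (conj _ h) _ _ := STP n in h).
have [T0 RT0 T0P] := closed_series (RM0 hpi) (RM_add hpi) (@RM_limit _ _ _ _ hpi)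
  (fun n => let: And3 _ (conj h _) _ := STP n in h)
  (fun n => let: And3 _ (conj _ h) _ := STP n in h).
exists S0, T0; split=> //; apply/funext => x; apply/eqP; rewrite -subr_eq0.
apply/eqP/nrm_le0.
apply: (@geometric_le0 _ ((M + K * 2 + K * 2) * nrm x)) => n.
have un : u n x = X x - (\sum_(k < n) S k x + \sum_(k < n) T k x).
  elim: n => [|n IH]; first by rewrite !big_ord0 addr0 subr0 u0.
  have [_ _ ->] := STP n.
  by rewrite IH !big_ord_recr /= -addrA -opprD addrACA.
have -> : X x - (S0 \+ T0) x =
    u n x - ((S0 x - \sum_(k < n) S k x) + (T0 x - \sum_(k < n) T k x)).
  by rewrite un [in RHS]addrACA -opprD opprB subrKA.
apply: le_trans (nrmB _ _) _.
apply: le_trans (lerD ((uP n).2 x) (nrmD _ _)) _.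
by have := S0P n x; have := T0P n x; lra.
Qed.

End Splitting.

Unset Implicit Arguments.
Set Strict Implicit.
Set Printing Implicit Defensive.

Theorem mainTheorem10 (R : realType) (A : cstarAlgType R) (H : hilbertType R)
    (pi : A -> H -> H) (hpi : universal_representation pi)
    (hQM : QM pi <> [set S \+ T | S in LM pi & T in RM pi]) :
  exists2 eps : R, 0 < eps &
    forall delta : R, 0 < delta ->
      exists2 h : H -> H, QM pi h &
        [/\ op_le (scalar_op (1 - delta)) h,
            op_le h (scalar_op (1 + delta)) &
            ~ exists T : H -> H,
                [/\ LM pi T, opnorm (T \- idfun) < eps &
                    adjoint T \o T = h]].
Proof.
have [rep _] := hpi.
(* Then |T^-1 - 1| <= 1/4, so the remainders of the real and imaginary parts of X
   add up to at most half of the norm of X. *)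
exists (1 / 8) => [|delta delta0]; first by rewrite divr_gt0.
apply: contrapT => noh; apply: hQM; apply/seteqP; split=> [X QX|X].
  have [|S [T [LS RT ->]]] := QM_sum rep delta0 _ QX; last by exists S => //; exists T.
  move=> h Qh lo up; apply: contrapT => noT; apply: noh.
  by exists h.
move=> [S LS [T RT <-]].
by apply: QM_add => //; [exact: LM_QM|exact: RM_QM].
Qed.
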